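(* The set of all stationary factorizing measure types on $\mathfrak F_{[0,1]}$ different from $\{\delta_{[0,1]}\}$, ordered by absolute continuity $\ll$, is a lattice. It is relatively complete and $\sigma$-complete and has a least element, $\{\delta_\emptyset\}$.
   Context: $\mathfrak F_{[0,1]}$ is the space of closed subsets of $[0,1]$ with the Fell topology and its Borel $\sigma$-field. A measure type is an equivalence class of probability measures under mutual absolute continuity; $\mathcal M'\ll\mathcal M$ means absolute continuity of representatives. For a probability measure $\mu$ on $\mathfrak F_{[0,1]}$: $\mu_{s,t}$ is its image under $Z\mapsto Z\cap[s,t]$; for $t\in[0,1]$, $\mu+t$ is its image under $Z\mapsto Z+t=(\{z+t:z\in Z\}\cup\{z+t-1:z\in Z\})\cap[0,1]$; $\mu_1\ast\mu_2$ is the image of $\mu_1\otimes\mu_2$ under $(Z_1,Z_2)\mapsto Z_1\cup Z_2$. These carry over to measure types. $\mathcal M$ is stationary factorizing if $\mathcal M_{r,t}=\mathcal M_{r,s}\ast\mathcal M_{s,t}$ for $0\le r<s<t\le1$ and $\mathcal M+t=\mathcal M$ for $t\in[0,1]$. A lattice $S$ is relatively complete if every order interval $[e,f]=\{s\in S:e\le s\le f\}$ is a complete lattice; it is $\sigma$-complete if every countable family has a greatest lower and a least upper bound. *)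

(* Defs.v *)
From HB Require Import structures.
From mathcomp Require Import all_boot all_order all_algebra.
From mathcomp Require Import all_classical all_reals all_analysis.

Set Implicit Arguments.
Unset Strict Implicit.
Unset Printing Implicit Defensive.

Import Order.TTheory GRing.Theory Num.Theory.
Import numFieldNormedType.Exports.

Local Open Scope classical_set_scope.
Local Open Scope ring_scope.

(* Order-theoretic notions for a subset X of a poset; all bounds are taken
   within X. *)
Section subposet.
Context {d : Order.disp_t} {T : porderType d}.
Implicit Types X A : set T.

Definition is_lub_in X A s :=
  (X `&` ubound A) s /\ lbound (X `&` ubound A) s.

Definition is_glb_in X A s :=
  (X `&` lbound A) s /\ ubound (X `&` lbound A) s.

Definition has_bounds_in X A :=
  (exists s, is_lub_in X A s) /\ (exists s, is_glb_in X A s).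

Definition is_lattice X :=
  forall x y, X x -> X y -> has_bounds_in X [set x; y].

Definition is_complete_lattice X :=
  forall A, A `<=` X -> has_bounds_in X A.

Definition order_interval X e f := X `&` [set x | (e <= x <= f)%O].

(* Without e <= f the interval would be empty, hence not a complete lattice. *)
Definition is_relatively_complete X :=
  forall e f, X e -> X f -> (e <= f)%O ->
    is_complete_lattice (order_interval X e f).

(* Families are nonempty: the greatest lower bound of the empty family would
   be a greatest element of X. *)
Definition is_sigma_complete X :=
  forall A, A `<=` X -> countable A -> A !=set0 -> has_bounds_in X A.

Definition is_least X x := X x /\ lbound X x.

End subposet.

Section measure_types.
Context {d : measure_display} {T : measurableType d} {R : realType}.

Definition equivalent_to (mu : set T -> \bar R) : set (probability T R) :=
  [set nu | nu `<< mu /\ mu `<< nu].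

Record mtype := MType {
  mtype_set :> set (probability T R);
  mtypeP : exists mu : probability T R, mtype_set = equivalent_to mu }.

HB.instance Definition _ := gen_eqMixin mtype.
HB.instance Definition _ := gen_choiceMixin mtype.

Definition mtype_of (mu : probability T R) : mtype :=
  MType (ex_intro _ mu erefl).

Definition mtype_ac (M' M : mtype) : bool :=
  `[< forall mu' mu, mtype_set M' mu' -> mtype_set M mu -> mu' `<< mu >].

Lemma mtype_ac_of (mu' mu : probability T R) :
  mtype_ac (mtype_of mu') (mtype_of mu) <-> mu' `<< mu.
Proof.
split=> [/asboolP h|h]; first by apply: h; split => /=.
apply/asboolP => nu' nu [nu'mu' _] [_ munu].
exact: null_dominates_trans (null_dominates_trans nu'mu' h) munu.
Qed.

Lemma mtypeE (M : mtype) : exists mu, M = mtype_of mu.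
Proof.
case: M => M [mu Mmu]; exists mu; rewrite /mtype_of; subst M.
by congr MType; exact: Prop_irrelevance.
Qed.

Lemma mtype_ac_refl : reflexive mtype_ac.
Proof. by move=> M; have [mu ->] := mtypeE M; apply/mtype_ac_of. Qed.

Lemma mtype_ac_anti : antisymmetric mtype_ac.
Proof.
move=> M N; have [mu ->] := mtypeE M; have [nu ->] := mtypeE N.
move=> /andP[/mtype_ac_of munu /mtype_ac_of numu].
have eqE : equivalent_to mu = equivalent_to nu.
  apply/seteqP; split=> la [h1 h2]; split.
  - exact: null_dominates_trans h1 munu.
  - exact: null_dominates_trans numu h2.
  - exact: null_dominates_trans h1 numu.
  - exact: null_dominates_trans munu h2.
rewrite /mtype_of; move: (ex_intro _ mu _) (ex_intro _ nu _).
by rewrite eqE => p q; congr MType; exact: Prop_irrelevance.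
Qed.

Lemma mtype_ac_trans : transitive mtype_ac.
Proof.
move=> N M L; have [mu ->] := mtypeE M; have [nu ->] := mtypeE N.
have [la ->] := mtypeE L => /mtype_ac_of h1 /mtype_ac_of h2.
by apply/mtype_ac_of; exact: null_dominates_trans h1 h2.
Qed.

Fact mtype_display : Order.disp_t. Proof. exact: Order.Disp tt tt. Qed.

HB.instance Definition _ := Order.Le_isPOrder.Build mtype_display mtype
  mtype_ac_refl mtype_ac_anti mtype_ac_trans.

End measure_types.
Arguments mtype {d} T R.

(* The space F_[0,1] of closed subsets of [0,1], represented as closed subsets
   of the line contained in [0,1]. *)
Record fell (R : realType) := Fell {
  fell_set :> set R;
  fell_closed : closed fell_set;
  fell_sub01 : fell_set `<=` `[0, 1]%classic }.

Section fell_space.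
Context {R : realType}.

HB.instance Definition _ := gen_eqMixin (fell R).
HB.instance Definition _ := gen_choiceMixin (fell R).

Definition fell_empty : fell R := Fell (@closed0 R) (@sub0set _ _).

Definition fell_full : fell R :=
  Fell (@itv_closed _ R 0 1) (@subset_refl _ _).

HB.instance Definition _ := isPointed.Build (fell R) fell_empty.

(* The Fell topology has as subbase the "hit" sets {Z | Z meets U}, U open, and
   the "miss" sets {Z | Z misses K}, K compact; the boolean selects between
   them. As every Z lies in [0,1], letting U and K range over subsets of the
   line gives the same family as subsets of [0,1]. *)
Definition fell_subbase (i : bool * set R) : set (fell R) :=
  if i.1 then [set Z : fell R | Z `&` i.2 !=set0]
  else [set Z : fell R | Z `&` i.2 = set0].

Definition fell_subbase_index : set (bool * set R) :=
  [set i | if i.1 then open i.2 else compact i.2].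

HB.instance Definition _ :=
  @isSubBaseTopological.Build (fell R) (bool * set R)%type
    fell_subbase_index fell_subbase.

End fell_space.

Definition fellB (R : realType) := g_sigma_algebraType (@open (fell R)).

Section fell_operations.
Context {R : realType}.
Implicit Types (s t : R) (Z : fell R).

Lemma fell_restrict_subproof s t Z :
  closed (Z `&` `[s, t]) /\ Z `&` `[s, t] `<=` `[0, 1].
Proof.
split; first by apply: closedI; [exact: fell_closed|exact: itv_closed].
by move=> x [/fell_sub01].
Qed.

Definition fell_restrict s t (Z : fellB R) : fellB R :=
  Fell (proj1 (fell_restrict_subproof s t Z))
       (proj2 (fell_restrict_subproof s t Z)).

Lemma closed_translate t (A : set R) : closed A -> closed [set z + t | z in A].
Proof.
move=> cA; have -> : [set z + t | z in A] = (fun x => x - t) @^-1` A.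
  apply/seteqP; split=> [_ [z Az <-]|x /= Axt]; first by rewrite /= addrK.
  by exists (x - t) => //; rewrite subrK.
apply: closed_comp => // x _.
by apply: cvgB; [exact: cvg_id|exact: cvg_cst].
Qed.

(* {z + t} \cup {z + t - 1}, before intersecting with [0,1]: no reduction
   modulo 1, so both endpoints 0 and 1 may appear. *)
Definition wrap_set t (A : set R) : set R :=
  [set z + t | z in A] `|` [set z + t - 1 | z in A].

Lemma fell_shift_subproof t Z :
  closed (wrap_set t Z `&` `[0, 1]) /\ wrap_set t Z `&` `[0, 1] `<=` `[0, 1].
Proof.
split; last by move=> x [].
apply: closedI; last exact: itv_closed.
apply: closedU; first by apply: closed_translate; exact: fell_closed.
rewrite (_ : [set _ | _ in _] = [set z + (t - 1) | z in (Z : set R)]).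
  by apply: closed_translate; exact: fell_closed.
by apply: eq_imagel => z _; rewrite addrA.
Qed.

Definition fell_shift t (Z : fellB R) : fellB R :=
  Fell (proj1 (fell_shift_subproof t Z)) (proj2 (fell_shift_subproof t Z)).

Lemma fell_union_subproof Z1 Z2 :
  closed (Z1 `|` Z2) /\ Z1 `|` Z2 `<=` `[0, 1].
Proof.
split; first by apply: closedU; exact: fell_closed.
by move=> x [] /fell_sub01.
Qed.

Definition fell_union (Z : fellB R * fellB R) : fellB R :=
  Fell (proj1 (fell_union_subproof Z.1 Z.2))
       (proj2 (fell_union_subproof Z.1 Z.2)).

End fell_operations.

(* The operations on measure types are taken on representatives. The maps
   fell_restrict s t, fell_shift t and fell_union are Borel measurable, so the
   set functions below are the image probabilities, and each result is a whole
   equivalence class. *)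
Section mtype_operations.
Context {R : realType}.
Implicit Types M : set (probability (fellB R) R).

Definition mtype_image (f : fellB R -> fellB R) M :
    set (probability (fellB R) R) :=
  \bigcup_(mu in M) equivalent_to (pushforward mu f).

Definition mtype_restrict s t M := mtype_image (fell_restrict s t) M.

Definition mtype_shift t M := mtype_image (fell_shift t) M.

Definition mtype_conv M1 M2 : set (probability (fellB R) R) :=
  \bigcup_(mu1 in M1) \bigcup_(mu2 in M2)
    equivalent_to (pushforward (mu1 \x mu2)%E fell_union).

Definition factorizing (M : mtype (fellB R) R) :=
  forall r s t, 0 <= r -> r < s -> s < t -> t <= 1 ->
    mtype_restrict r t M =
    mtype_conv (mtype_restrict r s M) (mtype_restrict s t M).

Definition stationary (M : mtype (fellB R) R) :=
  forall t, 0 <= t <= 1 -> mtype_shift t M = M.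

End mtype_operations.

Definition mtype_dirac (R : realType) (Z : fellB R) : mtype (fellB R) R :=
  mtype_of (\d_Z : probability (fellB R) R).

Definition stat_fact_types (R : realType) : set (mtype (fellB R) R) :=
  [set M | [/\ stationary M, factorizing M & M <> mtype_dirac fell_full]].
Arguments stat_fact_types R : clear implicits.

(* Main.v *)
Require Import Defs.
From HB Require Import structures.
From mathcomp Require Import all_boot all_order all_algebra.
From mathcomp Require Import finmap.
From mathcomp Require Import lra.
From mathcomp Require Import all_classical all_reals all_analysis.
Set Implicit Arguments.
Unset Strict Implicit.
Unset Printing Implicit Defensive.
Import Order.TTheory GRing.Theory Num.Theory.
Import numFieldNormedType.Exports.
Local Open Scope classical_set_scope.
Local Open Scope ring_scope.

(** The measure type of a probability [mu] is the same thing as its family of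
  null sets, so every condition on measure types below is read as a statement
  about almost sure events, and products are handled by Fubini: an event is
  almost sure for a product measure iff for almost every first coordinate it
  holds for almost every second one.

  Let [splice s x y] be the set that agrees with [x] on [[0, s]] and with [y] on
  [[s, 1]]. Cutting the whole interval once contains all cuts of subintervals,
  because restricting [splice s x y] to [[r, t]] gives exactly the union of
  [x] restricted to [[r, s]] and [y] restricted to [[s, t]]. So a type is
  factorizing iff [mu] is equivalent to the law of [splice s x y] with [x] and
  [y] independent of law [mu], for all [0 < s < 1].

  The type of the full interval is excluded exactly when the empty set is an
  atom of [mu] ([charges_emptyP]). Indeed, if [Z] is almost surely nonempty then
  by factorization one of two halves is almost surely hit, and by stationarity
  any interval of the same length is; so every interval is hit and
  [Z = [0, 1]]. This gives the least element. It also shows that 0 and 1, and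
  hence by stationarity all points of [[0, 1]], are almost surely not in [Z]:
  shifting by 0 and by 1 forces [0 \in Z] and [1 \in Z] to be the same event,
  while factorization at 1/2 makes these two events independent, and each of
  them fails with positive probability.

  The heart of the proof is that every nonempty family [F] of such laws has an
  infimum ([infimum_admissible]). Its null sets must be the sigma-ideal generated
  by the null sets of the members of [F]. By exhaustion any proper sigma-ideal
  containing the null sets of some [mu] is the ideal of null sets of [mu]
  restricted to a set ([sigma_ideal_probability]), so the infimum [pi] exists
  as a measure type. Stationarity and one half of factorization, that [pi]
  dominates its own splice, go through by induction on the generation of the
  ideal. The other half holds for every [pi] dominated by a stationary factorizing
  law, because a measure dominated by a product measure is dominated by
  the product of its own marginals ([dominated_factorizing]).

  Conversely a countable family is bounded: convolutions of such laws are again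
  such laws and, since the empty set is an atom, dominate both factors; the
  partial convolutions of a sequence increase, and a mixture of them bounds the
  sequence ([sequence_upper_bound]). Suprema are then the infima of the sets of
  upper bounds, and the remaining claims are order theory. *)

(** * The Borel sets of the Fell topology *)

Section fell_borel.
Context {R : realType}.
Implicit Types (Z : fell R) (O : set (fell R)) (A U K : set R).

Definition misses A : set (fellB R) := [set Z | Z `&` A = set0].

Definition interval_misses : set (set (fellB R)) :=
  [set W | exists a b : R, W = misses `[a, b]].

(** A countable family replacing the base of the topology. Hits are prescribed for
  closed intervals rather than open ones, so that the cells are built from misses
  of compact intervals only; they need not be open, but they are measurable. *)
Definition fell_cell (c : seq (rat * rat) * seq (rat * rat)) : set (fellB R) :=
  [set Z | (forall i, i \in c.1 -> misses `[ratr i.1, ratr i.2] Z) /\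
           (forall i, i \in c.2 -> ~ misses `[ratr i.1, ratr i.2] Z)].

Lemma missesP A Z : misses A Z <-> forall x, (Z : set R) x -> ~ A x.
Proof.
split=> [ZA0 x Zx Ax|ZA]; first by have : set0 x by rewrite -ZA0.
by apply/seteqP; split=> // x [/ZA].
Qed.

Lemma rat_itv_nbhs U x : open U -> U x ->
  exists i : rat * rat,
    ratr i.1 < x < ratr i.2 /\ `[ratr i.1, ratr i.2] `<=` U.
Proof.
move=> oU Ux; have /nbhs_ballP[e /= e0 eU] := open_nbhs_nbhs (conj oU Ux).
have [p] : exists p : rat, ratr p \in `]x - e, x[.
  by apply: rat_in_itvoo; rewrite ltrBlDr ltrDl.
have [q] : exists q : rat, ratr q \in `]x, x + e[.
  by apply: rat_in_itvoo; rewrite ltrDl.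
rewrite !in_itv/= => /andP[xq qe] /andP[ep px].
exists (p, q); split; first by rewrite /= px xq.
move=> y /=; rewrite in_itv/= => /andP[py yq]; apply: eU.
rewrite /ball/= ltr_distlC; apply/andP; split.
  exact: lt_le_trans py.
exact: le_lt_trans yq _.
Qed.

Lemma fell_cell_hit U Z : open U -> Z `&` U !=set0 ->
  exists c, fell_cell c Z /\ fell_cell c `<=` [set Y | Y `&` U !=set0].
Proof.
move=> oU [x [Zx Ux]]; have [i [/andP[ix xi] iU]] := rat_itv_nbhs oU Ux.
exists ([::], [:: i]); split; first split => //= j.
  rewrite inE => /eqP-> Zi0.
  by have : set0 x by rewrite -Zi0; split => //=; rewrite in_itv/= !ltW.
move=> Y [_ /(_ i (mem_head _ _))] /eqP/set0P[y [Yy yi]].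
by exists y; split => //; exact: iU.
Qed.

(** A compact set disjoint from the closed set [Z] is covered by finitely many
  rational intervals whose closures are disjoint from [Z]. *)
Lemma fell_cell_miss K Z : compact K -> Z `&` K = set0 ->
  exists c, fell_cell c Z /\ fell_cell c `<=` [set Y | Y `&` K = set0].
Proof.
rewrite compact_cover => cK ZK0.
pose D : set (rat * rat) := [set i | misses `[ratr i.1, ratr i.2] Z].
pose f (i : rat * rat) : set R := `]ratr i.1, ratr i.2[%classic.
have [||F FD KF] := cK _ D f.
- by move=> i _; exact: itv_open.
- move=> x Kx; have [||i [xi iZ]] := @rat_itv_nbhs (~` Z) x.
  + by rewrite openC; exact: fell_closed.
  + by move=> Zx; have : set0 x by rewrite -ZK0.
  exists i; last by rewrite /f/= in_itv.
  by apply/seteqP; split=> // y [Zy /iZ].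
exists (enum_fset F, [::]); split.
  by split=> //= i iF; have := FD _ iF; rewrite inE.
move=> Y [YF _]; apply/seteqP; split=> // x [Yx Kx].
have [i iF fix_] := KF _ Kx.
have <- := YF _ iF; split => //.
by apply: subset_itvW fix_; rewrite ?lexx.
Qed.

Lemma fell_cell_seq (s : seq (bool * set R)) Z :
  (forall i, i \in s -> fell_subbase_index i /\ fell_subbase i Z) ->
  exists c, fell_cell c Z /\
    fell_cell c `<=` [set Y | forall i, i \in s -> fell_subbase i Y].
Proof.
elim: s => [_|[b A] s IH sZ].
  by exists ([::], [::]); split; [split | move=> Y _ i].
have [|c [cZ cs]] := IH.
  by move=> i si; apply: sZ; rewrite inE si orbT.
have [c' [c'Z c's]] : exists c, fell_cell c Z /\
    fell_cell c `<=` fell_subbase (b, A).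
  have /= := sZ _ (mem_head _ _).
  rewrite /fell_subbase_index /fell_subbase/=; case: b {sZ} => /= -[].
    exact: fell_cell_hit.
  exact: fell_cell_miss.
exists (c.1 ++ c'.1, c.2 ++ c'.2); split.
  by split=> /= i; rewrite mem_cat => /orP[];
    [apply: cZ.1|apply: c'Z.1|apply: cZ.2|apply: c'Z.2].
move=> Y /= [Y1 Y2] i; rewrite inE => /orP[/eqP->|].
  by apply: c's; split=> j cj; [apply: Y1|apply: Y2]; rewrite mem_cat cj orbT.
by move: i; apply: cs; split=> j cj; [apply: Y1|apply: Y2]; rewrite mem_cat cj.
Qed.

Lemma fell_cell_open O Z : open O -> O Z ->
  exists c, fell_cell c Z /\ fell_cell c `<=` O.
Proof.
move=> [D' sD' <-] [W D'W WZ].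
have [F [sF FW]] : exists F : {fset (bool * set R)%type},
    {subset F <= fell_subbase_index} /\
    \bigcap_(i in [set` F]) fell_subbase i = W.
  by have [F sF FW] := sD' _ D'W; exists F.
have [|c [cZ cF]] := @fell_cell_seq (enum_fset F) Z.
  move=> i iF; split; first by have := sF _ iF; rewrite inE.
  by move: WZ; rewrite /isBaseTopological.b/= -FW; apply.
exists c; split=> // Y /cF FY; exists W => //.
by rewrite -FW.
Qed.

Lemma open_misses K : compact K -> open (misses K : set (fell R)).
Proof.
move=> cK.
exists [set fell_subbase (false, K)]; last by rewrite bigcup_set1.
move=> _ ->; exists (fset1 (false, K)).
  by move=> i; rewrite in_fset1 => /eqP ->; exact: mem_set.
by rewrite set_fset1 bigcap_set1.
Qed.

Lemma measurable_misses K : compact K -> measurable (misses K).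
Proof. by move=> cK; apply: sub_sigma_algebra; exact: open_misses. Qed.

(** Every open set is the union of the countably many cells that it contains. *)
Lemma fell_measurableE : @measurable _ (fellB R) = <<s interval_misses >>.
Proof.
apply/seteqP; split; last first.
  apply: smallest_sub; first exact: sigma_algebra_measurable.
  by move=> _ [a [b ->]]; apply: measurable_misses; exact: segment_compact.
apply: smallest_sub; first exact: smallest_sigma_algebra.
move=> O oO.
have -> : O = \bigcup_(c in [set c | fell_cell c `<=` O]) fell_cell c.
  apply/seteqP; split=> [Z OZ|Z [c]]; last exact.
  by have [c [cZ cO]] := fell_cell_open oO OZ; exists c.
pose S := g_sigma_algebraType interval_misses.
have mI a b : @measurable _ S (misses `[a, b]).
  by apply: sub_sigma_algebra; exists a, b.
rewrite bigcup_mkcond.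
apply: (@countable_bigcupT_measurable _ S); first exact: countableP.
move=> c; case: ifP => _; last exact: measurable0.
rewrite (_ : fell_cell c =
  (\bigcap_(i in [set` c.1]) misses `[ratr i.1, ratr i.2]) `&`
  (\bigcap_(i in [set` c.2]) ~` misses `[ratr i.1, ratr i.2])) //.
apply: (@measurableI _ S).
  by apply: (@fin_bigcap_measurable _ S) => // i _; exact: mI.
by apply: (@fin_bigcap_measurable _ S) => // i _; apply: measurableC; exact: mI.
Qed.

Lemma measurable_fun_fell d (T : measurableType d) (f : T -> fellB R) :
  (forall a b : R, measurable (f @^-1` misses `[a, b])) ->
  measurable_fun setT f.
Proof.
move=> mf; apply: (measurability _ fell_measurableE).
by move=> _ [_ [a [b ->]] <-]; rewrite setTI; exact: mf.
Qed.

Lemma measurable_fell_restrict s t : measurable_fun setT (@fell_restrict R s t).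
Proof.
apply: measurable_fun_fell => a b.
rewrite (_ : _ @^-1` _ = misses (`[s, t] `&` `[a, b])).
  apply: measurable_misses; apply: compact_closedI.
    exact: segment_compact.
  exact: itv_closed.
by apply/seteqP; split=> Z; rewrite /misses/= setIA.
Qed.

Lemma measurable_fell_shift t : measurable_fun setT (@fell_shift R t).
Proof.
apply: measurable_fun_fell => a b.
pose I := `[0, 1] `&` `[a, b] : set R.
rewrite (_ : _ @^-1` _ =
    misses [set y - t | y in I] `&` misses [set y - (t - 1) | y in I]).
  have mIt u : measurable (misses [set y - u | y in I]).
    apply: measurable_misses; apply: continuous_compact.
      apply: continuous_subspaceT => x.
      by apply: cvgB; [exact: cvg_id|exact: cvg_cst].
    by apply: compact_closedI; [exact: segment_compact|exact: itv_closed].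
  by apply: measurableI.
apply/seteqP; split=> Z; rewrite /preimage /=.
  move/missesP => Zt; split; apply/missesP => _ /[swap] -[y [y01 yab] <-] Zy;
    apply: (Zt y) => //; split=> //.
    by left; exists (y - t) => //; rewrite subrK.
  by right; exists (y - (t - 1)) => //; rewrite -addrA subrK.
move=> [/missesP Z1 /missesP Z2].
apply/missesP => _ [[[z Zz <-]|[z Zz <-]] z01] zab.
  by apply: (Z1 _ Zz); exists (z + t); rewrite ?addrK.
by apply: (Z2 _ Zz); exists (z + t - 1); rewrite ?opprB ?addrA ?subrK ?addrK.
Qed.

Lemma measurable_fell_union : measurable_fun setT (@fell_union R).
Proof.
apply: measurable_fun_fell => a b.
rewrite (_ : _ @^-1` _ = misses `[a, b] `*` misses `[a, b]).
  by apply: measurableX; apply: measurable_misses; exact: segment_compact.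
by apply/seteqP; split=> -[Z1 Z2]; rewrite /misses/= setIUl setU_eq0.
Qed.
End fell_borel.

(** * Almost sure events of products and images *)

Section almost_everywhere_products.
Context {d1 d2 : measure_display} {T1 : measurableType d1}
  {T2 : measurableType d2} {R : realType}.
Implicit Types (a : probability T1 R) (b : probability T2 R).
Implicit Types P : set (T1 * T2).
Local Open Scope ereal_scope.

Lemma eq_ae d (T : measurableType d) (mu : set T -> \bar R) (P Q : set T) :
  (forall x, P x <-> Q x) -> (\forall x \ae mu, P x) <-> (\forall x \ae mu, Q x).
Proof. by move=> PQ; rewrite (eq_near PQ). Qed.

Lemma ae_measurableP d (T : measurableType d) (mu : {measure set T -> \bar R})
  (P : set T) : measurable P -> (\forall x \ae mu, P x) <-> mu (~` P) = 0.
Proof. by move=> mP; apply: negligibleP; exact: measurableC. Qed.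

Lemma xsectionE P x : xsection P x = [set y | P (x, y)].
Proof. by apply/seteqP; split=> y; rewrite /xsection/= inE. Qed.

Lemma ysectionE P y : ysection P y = [set x | P (x, y)].
Proof. by apply/seteqP; split=> x; rewrite /ysection/= inE. Qed.

Lemma measurable_section P x : measurable P -> measurable [set y | P (x, y)].
Proof. by move=> mP; rewrite -(xsectionE P); exact: measurable_xsection. Qed.

Lemma measurable_preim d d' (S : measurableType d) (S' : measurableType d')
  (f : S -> S') (Q : set S') :
  measurable_fun setT f -> measurable Q -> measurable [set x | Q (f x)].
Proof. by move=> mf mQ; rewrite -[X in measurable X]setTI; exact: mf. Qed.

Lemma ae_xsectionP b P x : measurable P ->
  (\forall y \ae b, P (x, y)) <-> b (xsection (~` P) x) = 0.
Proof.
move=> mP; rewrite xsectionE.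
by apply: (@ae_measurableP _ _ b [set y | P (x, y)]);
  exact: measurable_section.
Qed.

Lemma ae_ysectionP a P y : measurable P ->
  (\forall x \ae a, P (x, y)) <-> a (ysection (~` P) y) = 0.
Proof.
move=> mP; rewrite ysectionE.
by apply: (@ae_measurableP _ _ a [set x | P (x, y)]); rewrite -(ysectionE P);
  exact: measurable_ysection.
Qed.

Lemma measurable_ae b P : measurable P ->
  measurable [set x | \forall y \ae b, P (x, y)].
Proof.
move=> mP; rewrite (_ : mkset _ = (b \o xsection (~` P)) @^-1` [set 0]).
  rewrite -[X in measurable X]setTI; apply: measurable_fun_xsection => //.
  exact: measurableC.
by apply/seteqP; split=> x /(ae_xsectionP _ _ mP).
Qed.

Lemma ae_prodP a b P : measurable P ->
  (\forall z \ae (a \x b), P z) <->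
  \forall x \ae a, \forall y \ae b, P (x, y).
Proof.
move=> mP; have mf := measurable_fun_xsection b (measurableC mP).
have /= ff := ae_eq_integral_abs a measurableT mf.
have -> : (\forall z \ae (a \x b), P z) <-> (a \x b) (~` P) = 0.
  exact: ae_measurableP.
have -> : (a \x b) (~` P) = \int[a]_x `|(b \o xsection (~` P)) x|.
  by apply: eq_integral => x _; rewrite gee0_abs.
rewrite ff /ae_eq; apply: eq_ae => x; split.
  by move=> /(_ I) /(ae_xsectionP _ _ mP).
by move=> /(ae_xsectionP _ _ mP).
Qed.

Lemma ae_swap a b P : measurable P ->
  (\forall x \ae a, \forall y \ae b, P (x, y)) <->
  \forall y \ae b, \forall x \ae a, P (x, y).
Proof.
move=> mP; apply: (iff_trans (iff_sym (ae_prodP _ _ mP))).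
have mf := measurable_fun_ysection a (measurableC mP).
have /= ff := ae_eq_integral_abs b measurableT mf.
have -> : (\forall z \ae (a \x b), P z) <-> (a \x b) (~` P) = 0.
  exact: ae_measurableP.
have -> : (a \x b) (~` P) = (a \x^ b) (~` P).
  apply: product_measure_unique; last exact: measurableC.
  by move=> A B mA mB; exact: product_measure2E.
have -> : (a \x^ b) (~` P) = \int[b]_y `|(a \o ysection (~` P)) y|.
  by apply: eq_integral => y _; rewrite gee0_abs.
rewrite ff /ae_eq; apply: eq_ae => y; split.
  by move=> /(_ I) /(ae_ysectionP _ _ mP).
by move=> /(ae_ysectionP _ _ mP).
Qed.

Lemma ae_pushforwardP a (f : T1 -> T2) (P : set T2) :
  measurable_fun setT f -> measurable P ->
  (\forall y \ae pushforward a f, P y) <-> \forall x \ae a, P (f x).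
Proof.
move=> mf mP; have mfP := measurable_preim mf mP.
rewrite (ae_measurableP a mfP).
exact: (@ae_measurableP _ _ (pushforward a f)).
Qed.
End almost_everywhere_products.

(** * Null sets and sigma-ideals *)

Section null_ideals.
Context {d : measure_display} {T : measurableType d} {R : realType}.
Implicit Types (mu nu : probability T R) (A B : set T) (N : set (set T)).
Local Open Scope ereal_scope.

Lemma dominatesP mu nu :
  mu `<< nu <-> forall A, measurable A -> nu A = 0 -> mu A = 0.
Proof. exact: null_content_dominatesP. Qed.

Lemma dominates_aeP mu nu : mu `<< nu <->
  forall P : set T, measurable P ->
    (\forall x \ae nu, P x) -> \forall x \ae mu, P x.
Proof.
rewrite dominatesP; split=> [h P mP /(ae_measurableP _ mP) nuP|h A mA nuA].
  by apply/(ae_measurableP _ mP); apply: h => //; exact: measurableC.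
have mA' := measurableC mA; rewrite -[A]setCK.
by apply/(ae_measurableP _ mA')/(h _ mA')/(ae_measurableP _ mA'); rewrite setCK.
Qed.

Lemma measurable_imply (P Q : set T) :
  measurable P -> measurable Q -> measurable [set x | P x -> Q x].
Proof.
move=> mP mQ; rewrite (_ : mkset _ = ~` P `|` Q).
  by apply: measurableU => //; exact: measurableC.
by apply/seteqP; split=> x /=; case: (pselect (P x)); tauto.
Qed.

Definition sigma_ideal N :=
  [/\ N `<=` measurable, N set0,
      forall A B, N A -> measurable B -> B `<=` A -> N B &
      forall F : nat -> set T, (forall n, N (F n)) -> N (\bigcup_n F n)].

Lemma sigma_idealU N A B : sigma_ideal N -> N A -> N B -> N (A `|` B).
Proof.
move=> [_ N0 _ NU] NA NB; rewrite -bigcup2E; apply: NU => n.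
by rewrite /bigcup2; case: ifP => // _; case: ifP.
Qed.

Lemma null_sigma_ideal mu : sigma_ideal [set A | measurable A /\ mu A = 0].
Proof.
split.
- by move=> A [].
- by split; [exact: measurable0|exact: measure0].
- by move=> A B [mA muA] mB BA; split=> //; exact: subset_measure0 BA muA.
- move=> G NG; have mG : measurable (\bigcup_n G n).
    by apply: bigcup_measurable => n _; exact: (NG n).1.
  split=> //; apply: measure_negligible mG _; apply: negligible_bigcup => n.
  by apply/negligibleP; [exact: (NG n).1|exact: (NG n).2].
Qed.

(** Choose members of [N] whose measure tends to the supremum over [N]: their
  union attains the supremum, so nothing in [N] outside it has positive
  measure. *)
Lemma sigma_ideal_exhaustion mu N : sigma_ideal N ->
  exists2 A, N A & forall B, N B -> mu (B `\` A) = 0.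
Proof.
move=> idN; have [Nm N0 NS NU] := idN; pose S := [set mu A | A in N].
have Sfin : ereal_sup S \is a fin_num.
  rewrite ge0_fin_numE; last first.
    by apply: ereal_sup_ubound; exists set0; rewrite ?measure0.
  apply: (@le_lt_trans _ _ 1); last by rewrite ltry.
  apply: ge_ereal_sup => _ [A NA <-]; apply: probability_le1; exact: Nm.
have /choice[F FN] : forall n, exists A,
    N A /\ ereal_sup S - (n.+1%:R^-1)%:E < mu A.
  move=> n; have n0 : (0 < n.+1%:R^-1 :> R)%R by [].
  by have [_ [A NA <-] ?] := ub_ereal_sup_adherent n0 Sfin; exists A.
have NF : N (\bigcup_n F n) by apply: NU => n; exact: (FN n).1.
exists (\bigcup_n F n) => // B NB; set A := \bigcup_n F n in NF *.
have mA := Nm _ NF; have mB := Nm _ NB.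
have supA : ereal_sup S <= mu A.
  apply/lee_addgt0Pr => e e0; have [n] := ltr_add_invr e0; rewrite add0r => ne.
  have [NFn /ltW] := FN n; rewrite leeBlDr// => /le_trans; apply.
  apply: leeD; last by rewrite lee_fin ltW.
  by apply: le_measure; rewrite ?inE//; [exact: Nm|exact: bigcup_sup].
have : mu A + mu (B `\` A) <= mu A + 0.
  rewrite adde0 -measureU//; last first.
  - by rewrite setDE setICA setICr setI0.
  - exact: measurableD.
  apply: (le_trans _ supA); apply: ereal_sup_ubound; exists (A `|` B `\` A) => //.
  apply: sigma_idealU => //; apply: NS NB _ _; [exact: measurableD|].
  exact: subDsetl.
rewrite leeD2lE ?fin_num_measure// => h; apply/eqP.
by rewrite -measure_le0.
Qed.

(** The probability is [mu] conditioned on the complement of a member of [N] that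
  is largest up to [mu]-null sets. *)
Lemma sigma_ideal_probability mu N : sigma_ideal N -> ~ N setT ->
  (forall A, measurable A -> mu A = 0 -> N A) ->
  exists pi : probability T R, forall B, measurable B -> pi B = 0 <-> N B.
Proof.
move=> idN NT muN; have [Nm N0 NS NU] := idN.
have [A NA Amax] := sigma_ideal_exhaustion mu idN.
have mA := Nm _ NA; have mE := measurableC mA.
have mT0 : mrestr mu mE setT != 0.
  apply/eqP; rewrite /mrestr setTI => muE; apply: NT.
  by rewrite -(setUv A); apply: sigma_idealU => //; exact: muN.
have mToo : mrestr mu mE setT < +oo.
  by rewrite /mrestr setTI; apply: (le_lt_trans (probability_le1 mu mE));
    rewrite ltry.
exists (mnormalize (mrestr mu mE) mu) => B mB.
rewrite -[X in X <-> _]/(mnormalize (mrestr mu mE) mu B = 0) /mnormalize.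
rewrite (negbTE mT0) (lt_eqF mToo)/=; split.
  move=> /eqP; rewrite mule_eq0 => /orP[/eqP BE|].
    rewrite -(setUIDK B A); apply: sigma_idealU => //.
      by apply: NS NA _ _; [exact: measurableI|exact: subIsetr].
    by apply: muN; [exact: measurableD|rewrite setDE].
  have : mrestr mu mE setT \is a fin_num by rewrite ge0_fin_numE.
  by move=> mTfin; rewrite eqe invr_eq0 fine_eq0 ?(negbTE mT0).
by move=> /Amax; rewrite setDE /mrestr => ->; rewrite mul0e.
Qed.

(** The normalized mixture with summable positive weights has the required null
  sets. *)
Lemma sequence_probability (u : nat -> probability T R) :
  exists pi : probability T R, forall B, measurable B ->
    pi B = 0 <-> forall n, u n B = 0.
Proof.
have w_ge0 n : (0 <= (2 ^ n.+1)%:R^-1 :> R)%R by rewrite invr_ge0.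
pose w n := NngNum (w_ge0 n).
pose m := mseries (fun n => mscale (w n) (u n)) 0.
have w0 n : (w n)%:num%:E != 0 :> \bar R.
  by rewrite eqe/= invr_eq0 pnatr_eq0 -lt0n expn_gt0.
have mE B : measurable B -> m B = 0 <-> forall n, u n B = 0.
  move=> mB; rewrite /m /mseries; split=> [h n|h].
    have /eqP : mscale (w n) (u n) B = 0.
      apply/eqP; rewrite -measure_le0 -[leRHS]h.
      apply: le_trans (nneseries_lim_ge n.+1 _) => //.
      by rewrite big_nat_recr//= leeDr// sume_ge0.
    by rewrite mule_eq0 (negbTE (w0 n)) => /eqP.
  apply: eseries0 => n _ _; rewrite -[LHS]/((w n)%:num%:E * u n B).
  by rewrite h mule0.
have mT0 : m setT != 0.
  apply/eqP => /(mE _ measurableT)/(_ 0%N); rewrite probability_setT.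
  exact/eqP/onee_neq0.
have mToo : m setT < +oo.
  apply: (@le_lt_trans _ _ 1); last by rewrite ltry.
  apply: le_trans (epsilon_trick0 xpredT ler01).
  rewrite /m /mseries; apply: lee_nneseries => // n _.
  rewrite -[leLHS]/((w n)%:num%:E * u n setT).
  by rewrite probability_setT mule1 mul1r.
exists (mnormalize m (u 0%N)) => B mB.
rewrite -[X in X <-> _]/(mnormalize m (u 0%N) B = 0) /mnormalize.
rewrite (negbTE mT0) (lt_eqF mToo)/= -mE//; split=> [/eqP|mB0];
  last by apply/eqP; rewrite mule_eq0; apply/orP; left; exact/eqP.
have mTfin : m setT \is a fin_num by rewrite ge0_fin_numE.
by rewrite mule_eq0 eqe invr_eq0 fine_eq0// (negbTE mT0) orbF => /eqP.
Qed.
End null_ideals.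

(** * Operations on representatives *)

Section images_of_laws.
Context {R : realType}.
Local Notation T := (fellB R).
Implicit Types (mu nu a b : probability T R) (P : set T) (x y : T) (s t : R).

HB.instance Definition _ s t := @isMeasurableFun.Build _ _ T T
  (@fell_restrict R s t) (measurable_fell_restrict s t).
HB.instance Definition _ t := @isMeasurableFun.Build _ _ T T
  (@fell_shift R t) (measurable_fell_shift t).
HB.instance Definition _ := @isMeasurableFun.Build _ _ (T * T)%type T
  (@fell_union R) measurable_fell_union.

Lemma equivalent_toP mu nu : equivalent_to mu = equivalent_to nu <->
  forall P, measurable P -> (\forall x \ae mu, P x) <-> \forall x \ae nu, P x.
Proof.
split=> [mnE|mn].
  have : equivalent_to nu mu by rewrite -mnE; split.
  by move=> [/dominates_aeP h1 /dominates_aeP h2] P mP; split; [exact: h2|exact: h1].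
have h1 : mu `<< nu by apply/dominates_aeP => P /mn[].
have h2 : nu `<< mu by apply/dominates_aeP => P /mn[].
by apply/seteqP; split=> p [p1 p2]; split;
  by [apply: null_dominates_trans p1 _|apply: null_dominates_trans p2].
Qed.

Lemma equivalent_to_refl mu : equivalent_to mu mu.
Proof. by split. Qed.

Lemma equivalent_to_ae mu nu P : equivalent_to mu nu -> measurable P ->
  (\forall x \ae nu, P x) <-> \forall x \ae mu, P x.
Proof.
by move=> [/dominates_aeP h1 /dominates_aeP h2] mP; split; [exact: h2|exact: h1].
Qed.

Lemma ae_distribution mu (f : {mfun T >-> T}) P : measurable P ->
  (\forall x \ae distribution mu f, P x) <-> \forall x \ae mu, P (f x).
Proof. by move=> mP; exact: ae_pushforwardP. Qed.

Definition convolution a b : probability T R :=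
  distribution (a \x b)%E (@fell_union R).

Lemma measurable_union_section P : measurable P ->
  measurable [set z : T * T | P (fell_union z)].
Proof. exact: measurable_preim measurable_fell_union. Qed.

Lemma ae_convolution a b P : measurable P ->
  (\forall x \ae convolution a b, P x) <->
  \forall x \ae a, \forall y \ae b, P (fell_union (x, y)).
Proof.
move=> mP; rewrite -[X in _ <-> X](ae_prodP _ _ (measurable_union_section mP)).
exact: (@ae_pushforwardP _ _ _ _ _ (a \x b)%E).
Qed.

Lemma mtype_imageE mu (f : {mfun T >-> T}) :
  mtype_image f (equivalent_to mu) = equivalent_to (distribution mu f).
Proof.
have eq_image nu : equivalent_to mu nu ->
    equivalent_to (distribution nu f) = equivalent_to (distribution mu f).
  move=> mn; apply/equivalent_toP => P mP; rewrite !ae_distribution//.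
  apply: (equivalent_to_ae mn).
  exact: measurable_preim (measurable_funPT f) mP.
apply/seteqP; split=> [p [nu /eq_image <-]//|p pf].
by exists mu => //; exact: equivalent_to_refl.
Qed.

Lemma mtype_convE a b :
  mtype_conv (equivalent_to a) (equivalent_to b) = equivalent_to (convolution a b).
Proof.
have eq_conv a' b' : equivalent_to a a' -> equivalent_to b b' ->
    equivalent_to (convolution a' b') = equivalent_to (convolution a b).
  move=> aa' bb'; apply/equivalent_toP => P mP; rewrite !ae_convolution//.
  have mU := measurable_union_section mP.
  apply: (iff_trans (equivalent_to_ae aa' (measurable_ae b' mU))).
  apply: eq_ae => x; apply: (equivalent_to_ae bb').
  exact: measurable_section mU.
apply/seteqP; split=> [p [a' aa' [b' bb']]|p pab]; first by rewrite -(eq_conv a' b').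
by exists a; [|exists b] => //; exact: equivalent_to_refl.
Qed.
End images_of_laws.

(** * Stationarity and factorization as properties of a law *)

Section laws.
Context {R : realType}.
Local Notation T := (fellB R).
Implicit Types (mu nu a b : probability T R) (P : set T) (x y : T) (s t : R).

Definition splice s x y : T := fell_union (fell_restrict 0 s x, fell_restrict s 1 y).

Definition stationary_law mu := forall t P, 0 <= t <= 1 -> measurable P ->
  (\forall x \ae mu, P (fell_shift t x)) <-> \forall x \ae mu, P x.

(** Only the cuts of the whole interval are required; by
  [fell_restrict_splice] these give the cuts of all subintervals. *)
Definition factorizing_law mu := forall s P, 0 < s < 1 -> measurable P ->
  (\forall x \ae mu, P x) <->
  \forall x \ae mu, \forall y \ae mu, P (splice s x y).

(** Says that the empty set is an atom, in the form in which it is used: under an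
  almost sure statement one may substitute the empty set for the variable. *)
Definition charges_empty mu := forall P,
  (\forall x \ae mu, P x) -> P (@fell_empty R).

Lemma fell_eq (Z1 Z2 : fell R) :
  (forall z : R, (Z1 : set R) z <-> (Z2 : set R) z) -> Z1 = Z2.
Proof.
case: Z1 => A cA A01; case: Z2 => B cB B01 /= AB.
have {}AB : A = B by apply/seteqP; split=> z /AB.
by subst B; congr Fell; exact: Prop_irrelevance.
Qed.

Lemma fell_restrict01 x : fell_restrict 0 1 x = x.
Proof.
apply: fell_eq => z; split=> [[]//|xz]; split=> //.
exact: fell_sub01 xz.
Qed.

Lemma fell_restrict_splice r s t x y : 0 <= r -> r < s -> s < t -> t <= 1 ->
  fell_restrict r t (splice s x y) =
  fell_union (fell_restrict r s x, fell_restrict s t y).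
Proof.
move=> r0 rs st t1; apply: fell_eq => z /=; rewrite !in_itv/=; split.
  move=> [[[xz /andP[z0 zs]]|[yz /andP[sz z1]]] /andP[rz zt]].
    by left; split=> //; apply/andP.
  by right; split=> //; apply/andP.
move=> [[xz /andP[rz zs]]|[yz /andP[sz zt]]].
  split; [left; split=> //|]; apply/andP; split=> //.
    exact: le_trans rz.
  exact: le_trans (ltW st).
split; [right; split=> //|]; apply/andP; split=> //.
  exact: le_trans t1.
exact: le_trans (ltW rs) sz.
Qed.

Lemma measurable_splice s P : measurable P ->
  measurable [set z : T * T | P (splice s z.1 z.2)].
Proof.
move=> mP.
have mg : measurable_fun setT (fun z : T * T =>
    (fell_restrict 0 s z.1, fell_restrict s 1 z.2) : T * T).
  apply: measurable_fun_pair.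
    apply: measurableT_comp; [exact: measurable_fell_restrict|exact: measurable_fst].
  apply: measurableT_comp; [exact: measurable_fell_restrict|exact: measurable_snd].
exact: measurable_preim mg (measurable_union_section mP).
Qed.

Lemma ae_factor mu r s t P : measurable P ->
  (\forall x \ae convolution (distribution mu (fell_restrict r s))
                 (distribution mu (fell_restrict s t)), P x) <->
  \forall x \ae mu, \forall y \ae mu,
    P (fell_union (fell_restrict r s x, fell_restrict s t y)).
Proof.
move=> mP; have mU := measurable_union_section mP.
apply: (iff_trans (ae_convolution _ _ mP)).
apply: (iff_trans (ae_distribution mu (fell_restrict r s) (measurable_ae _ mU))).
apply: eq_ae => x.
by apply: (ae_distribution mu (fell_restrict s t)); exact: measurable_section mU.
Qed.

Lemma stationaryP mu : stationary (mtype_of mu) <-> stationary_law mu.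
Proof.
split=> st t => [P t01 mP|t01].
  have := st t t01; rewrite /mtype_shift mtype_imageE => /equivalent_toP/(_ P mP).
  by rewrite ae_distribution.
rewrite /mtype_shift mtype_imageE; apply/equivalent_toP => P mP.
by rewrite ae_distribution//; exact: st.
Qed.

Lemma factorizingP mu : factorizing (mtype_of mu) <-> factorizing_law mu.
Proof.
split=> [fac s P /andP[s0 s1] mP|fac r s t r0 rs st t1].
  have := fac 0 s 1 (lexx _) s0 s1 (lexx _).
  rewrite /mtype_restrict !mtype_imageE mtype_convE => /equivalent_toP/(_ P mP).
  rewrite ae_distribution// ae_factor// => <-.
  by apply: eq_ae => x /=; rewrite fell_restrict01.
rewrite /mtype_restrict !mtype_imageE mtype_convE; apply/equivalent_toP => P mP.
rewrite ae_distribution// ae_factor//.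
have s01 : 0 < s < 1 by rewrite (le_lt_trans r0 rs) (lt_le_trans st t1).
apply: (iff_trans (fac s _ s01 _)).
  exact: measurable_preim (measurable_fell_restrict r t) mP.
by apply: eq_ae => x; apply: eq_ae => y /=; rewrite fell_restrict_splice.
Qed.

Lemma mtype_of_eq mu nu :
  (forall P, measurable P -> (\forall x \ae mu, P x) <-> \forall x \ae nu, P x) ->
  mtype_of mu = mtype_of nu.
Proof.
move=> mn; apply/eqP; rewrite eq_le; apply/andP; split; apply/mtype_ac_of;
  by apply/dominates_aeP => P /mn[].
Qed.

Lemma ae_cst mu (Q : Prop) : (\forall x \ae mu, Q) -> Q.
Proof.
move=> Qae; apply: contrapT => nQ.
have : \forall x \ae mu, (set0 : set T) x by apply: filterS Qae.
move=> /(ae_measurableP mu measurable0); rewrite setC0 => mu0.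
by have /eqP := etrans (esym (probability_setT mu)) mu0; rewrite onee_eq0.
Qed.

Lemma ae_or mu (A B : T -> Prop) :
  (\forall x \ae mu, \forall y \ae mu, A x \/ B y) <->
  (\forall x \ae mu, A x) \/ \forall y \ae mu, B y.
Proof.
split=> [AB|[Ae|Be]].
- have [Be|nBe] := pselect (\forall y \ae mu, B y); [by right|left].
  apply: filterS AB => x ABx; apply: contrapT => nAx; apply: nBe.
  by apply: filterS ABx => y [].
- by apply: filterS Ae => x Ax; apply: aeW => y; left.
- by apply: aeW => x; apply: filterS Be => y By; right.
Qed.

Definition hits mu (u v : R) := \forall x \ae mu, ~ misses `[u, v] x.

Lemma measurable_misses_itv (u v : R) : measurable (~` misses `[u, v] : set T).
Proof. by apply: measurableC; apply: measurable_misses; exact: segment_compact. Qed.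

Lemma hits_split mu s t : factorizing_law mu -> 0 < s -> s < t -> t <= 1 ->
  hits mu 0 t -> hits mu 0 s \/ hits mu s t.
Proof.
move=> fac s0 st t1 h; apply/ae_or.
have s01 : 0 < s < 1 by rewrite s0 (lt_le_trans st).
move: h => /(fac s _ s01 (measurable_misses_itv 0 t)).
apply: filterS => x; apply: filterS => y /= xy.
have [x0|] := pselect (misses `[0, s] x); last by left.
right=> y0; apply: xy; apply/missesP => z /=; rewrite in_itv/=.
move=> [[xz]|[yz]]; rewrite in_itv/= => /andP[lz zu] /andP[z0 zt].
  by move/missesP: x0 => /(_ z xz); apply; rewrite /= in_itv/= z0.
by move/missesP: y0 => /(_ z yz); apply; rewrite /= in_itv/= lz.
Qed.

(** The translation is by [u' - u] when this is nonnegative, and by its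
  representative [1 + u' - u] modulo 1 otherwise. *)
Lemma hits_translate mu (u v u' v' : R) : stationary_law mu ->
  0 <= u -> v <= 1 -> 0 <= u' -> v' <= 1 -> u <= v -> v' - u' = v - u ->
  hits mu u v -> hits mu u' v'.
Proof.
move=> sta u0 v1 u0' v1' uv uv'; rewrite /hits => h.
have v'E : v' = u' + (v - u) by rewrite -uv' addrC subrK.
have [uu'|u'u] := leP u u'.
  apply/(sta (u' - u) _ _ (measurable_misses_itv u' v')).
    by rewrite subr_ge0 uu'/=; lra.
  apply: filterS h => x /= hx /missesP hx'; apply: hx; apply/missesP => z xz.
  rewrite /= in_itv/= => /andP[uz zv].
  apply: (hx' (z + (u' - u))); last by rewrite /= in_itv/=; apply/andP; split; lra.
  split; first by left; exists z.
  by rewrite /= in_itv/=; apply/andP; split; lra.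
apply/(sta (1 + u' - u) _ _ (measurable_misses_itv u' v')).
  by apply/andP; split; lra.
apply: filterS h => x /= hx /missesP hx'; apply: hx; apply/missesP => z xz.
rewrite /= in_itv/= => /andP[uz zv].
apply: (hx' (z + (1 + u' - u) - 1)); last first.
  by rewrite /= in_itv/=; apply/andP; split; lra.
split; first by right; exists z.
by rewrite /= in_itv/=; apply/andP; split; lra.
Qed.

(** If some interval were missed with positive probability, so would be an
  interval of length [1/n], hence by translation all intervals of that length.
  Adding these one at a time from 0 with [hits_split], the whole interval would
  be missed with positive probability. *)
Lemma hits_all mu (u v : R) : stationary_law mu -> factorizing_law mu ->
  0 <= u -> u < v -> v <= 1 -> hits mu 0 1 -> hits mu u v.
Proof.
move=> sta fac u0 uv v1 h01; apply: contrapT => nuv.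
have [n] : exists k : nat, 0 + k.+1%:R^-1 < v - u by apply: ltr_add_invr; lra.
rewrite add0r => nvu.
pose e : R := n.+1%:R^-1.
have e0 : 0 < e by rewrite invr_gt0.
have nue : ~ hits mu u (u + e).
  move=> h; apply: nuv; apply: filterS h => x hx /missesP xuv; apply: hx.
  apply/missesP => z /xuv nz; rewrite /= in_itv/= => /andP[uz zu]; apply: nz.
  by rewrite /= in_itv/= uz/=; rewrite -/e in nvu; lra.
have ne c : 0 <= c -> c + e <= 1 -> ~ hits mu c (c + e).
  move=> c0 ce; apply: contra_not nue; apply: hits_translate => //; try lra.
  by rewrite -/e in nvu; lra.
have : forall k, (k < n.+1)%N -> ~ hits mu 0 (k.+1%:R * e).
  elim=> [_|k IH kn].
    by rewrite mul1r -[X in hits _ _ X]add0r; apply: ne;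
      rewrite // add0r invf_le1// ler1n.
  have ke : k.+2%:R * e = k.+1%:R * e + e.
    by rewrite -[k.+2]addn1 natrD mulrDl mul1r.
  have ke1 : k.+2%:R * e <= 1 by rewrite ler_pdivrMr// mul1r ler_nat.
  rewrite ke in ke1 * => h0.
  have [||h|h] := hits_split (s := k.+1%:R * e) fac _ _ ke1 h0.
  - by rewrite mulr_gt0.
  - by rewrite ltrDl.
  - by apply: IH h; exact: ltnW.
  - by apply: ne h => //; rewrite mulr_ge0// ltW.
by move=> /(_ n (ltnSn _)); rewrite mulfV.
Qed.
End laws.

(** * Laws charging the empty set *)

Section admissible_laws.
Context {R : realType}.
Local Notation T := (fellB R).
Implicit Types (mu nu : probability T R) (P : set T) (x y : T) (s t : R).

Lemma dense_fell_full x :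
  (forall p q : rat, 0 <= ratr p :> R -> ratr p < ratr q :> R ->
     ratr q <= 1 :> R -> ~ misses `[ratr p, ratr q] x) ->
  x = fell_full.
Proof.
move=> hx; apply: fell_eq => z; split; first exact: fell_sub01.
rewrite /= in_itv/= => /andP[z0 z1]; apply: contrapT => nxz.
have [e /= e0 eU] : nbhs_ball z (~` (x : set R)).
  by apply/nbhs_ballP/open_nbhs_nbhs; split => //; rewrite openC; exact: fell_closed.
have [p] : exists p : rat, ratr p \in `]Num.max 0 (z - e), Num.min 1 (z + e)[.
  by apply: rat_in_itvoo; rewrite lt_min !gt_max ltr01/=; apply/and3P; split; lra.
rewrite in_itv/= gt_max => /andP[/andP[p0 ep] pm].
have [q] := rat_in_itvoo pm; rewrite in_itv/= lt_min => /andP[pq /andP[q1 qe]].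
apply: (hx p q (ltW p0) pq (ltW q1)); apply/missesP => w xw.
rewrite /= in_itv/= => /andP[pw wq]; apply: (eU w) => //.
by rewrite /ball/= ltr_distlC; apply/andP; split; lra.
Qed.

Lemma ae_diracP x P : measurable P ->
  (\forall y \ae (\d_x : probability T R), P y) <-> P x.
Proof.
move=> mP; apply: (iff_trans (ae_measurableP _ mP)).
rewrite -[X in X = _]/(\d_x (~` P)) diracE; split=> [/eqP|Px].
  by case: (pselect (P x)) => // nPx; rewrite mem_set// onee_eq0.
by rewrite memNset.
Qed.

(** If the empty set is not an atom, [hits_all] applied to countably many rational
  intervals makes the random set almost surely dense, hence full. *)
Lemma charges_emptyP mu : stationary_law mu -> factorizing_law mu ->
  mtype_of mu <> mtype_dirac fell_full <-> charges_empty mu.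
Proof.
move=> sta fac; split=> [nfull P Pae|ce mufull].
- apply: contrapT => nP; apply: nfull.
  have h01 : hits mu 0 1.
    apply: filterS Pae => x Px /missesP x0; apply: nP.
    rewrite (_ : fell_empty = x)//; apply: fell_eq => z; split=> // xz.
    by have := x0 _ xz; have := fell_sub01 xz.
  have : \forall x \ae mu, forall n,
      forall p q : rat, choice.pickle (p, q) = n ->
        0 <= ratr p :> R -> ratr p < ratr q :> R -> ratr q <= 1 :> R ->
        ~ misses `[ratr p, ratr q] x.
    apply: ae_foralln => n; have [[[p q] <-]|nn] :=
      pselect (exists i : rat * rat, choice.pickle i = n); last first.
      by apply: aeW => x p q pqn; exfalso; apply: nn; exists (p, q).
    suff : \forall x \ae mu, 0 <= ratr p :> R -> ratr p < ratr q :> R ->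
        ratr q <= 1 :> R -> ~ misses `[ratr p, ratr q] x.
      by apply: filterS => x hx p' q' /(pcan_inj choice.pickleK)[-> ->].
    have [p0|p0] := boolP (0 <= ratr p :> R); last exact: aeW.
    have [pq|pq] := boolP (ratr p < ratr q :> R); last exact: aeW.
    have [q1|q1] := boolP (ratr q <= 1 :> R); last exact: aeW.
    by apply: filterS (hits_all sta fac p0 pq q1 h01).
  move=> full; have {}full : \forall x \ae mu, x = (fell_full : T).
    apply: filterS full => x hx; apply: dense_fell_full => p q.
    exact: hx.
  apply: mtype_of_eq => Q mQ; rewrite ae_diracP//; split=> [Qae|Qf].
    have : \forall x \ae mu, Q fell_full.
      by apply: filterS2 full Qae => x ->.
    exact: ae_cst.
  by apply: filterS full => x ->.
- suff : \forall x \ae mu, (~` misses `[0, 1]) x.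
    by move=> /ce /= nm; apply: nm; exact/missesP.
  have /equivalent_toP h : equivalent_to mu =
      equivalent_to (\d_(@fell_full R : T) : probability T R).
    by have := congr1 (fun M : mtype T R => mtype_set M) mufull.
  apply/h; first exact: measurable_misses_itv.
  apply/ae_diracP; first exact: measurable_misses_itv.
  by move=> /missesP/(_ 0); rewrite /= in_itv/= lexx ler01; apply.
Qed.

Definition admissible mu :=
  [/\ stationary_law mu, factorizing_law mu & charges_empty mu].

Lemma stat_fact_typesP mu : stat_fact_types R (mtype_of mu) <-> admissible mu.
Proof.
split=> [[/stationaryP sta /factorizingP fac nf]|[sta fac ce]].
  by split=> //; exact/charges_emptyP.
by split; [exact/stationaryP|exact/factorizingP|exact/charges_emptyP].
Qed.

Definition through (z : R) : set T := [set x | (x : set R) z].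

Lemma measurable_through (z : R) : measurable (through z).
Proof.
rewrite (_ : through z = ~` misses [set z]).
  by apply: measurableC; apply: measurable_misses; exact: compact_set1.
apply/seteqP; split=> x /=.
  by move=> xz /missesP/(_ z xz); apply.
by move=> nm; apply: contrapT => nxz; apply: nm; apply/missesP => w + wz; rewrite wz.
Qed.

(** The shifts by 0 and by 1 are not the identity: they add 0 when 1 is present,
  respectively 1 when 0 is present. So stationarity makes the presence of 0 and
  of 1 equivalent, whereas factorization at 1/2 decides them independently;
  putting the empty set on either side excludes both. *)
Lemma admissible_endpoints mu : admissible mu ->
  \forall x \ae mu, ~ through 0 x /\ ~ through 1 x.
Proof.
move=> [sta fac ce].
have e0 (z : R) : ~ through z fell_empty by [].
have half01 : 0 < (2^-1 : R) < 1 by apply/andP; split; lra.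
have mimp (u v : R) : measurable [set x : T | through u x -> through v x].
  by apply: measurable_imply; exact: measurable_through.
have /(fac _ _ half01 (mimp 1 0)) ae10 :
    \forall x \ae mu, through 1 x -> through 0 x.
  apply: (iffLR (sta 0 _ _ (mimp 1 0))); first by rewrite lexx ler01.
  apply: aeW => x; rewrite /through/= /wrap_set/= !in_itv/= !lexx !ler01/=.
  move=> [[[w xw we]|[w xw we]] _]; split=> //; first by right; exists w => //; lra.
  by have := fell_sub01 xw; rewrite /= in_itv/= => /andP[]; lra.
have /(fac _ _ half01 (mimp 0 1)) ae01 :
    \forall x \ae mu, through 0 x -> through 1 x.
  apply: (iffLR (sta 1 _ _ (mimp 0 1))); first by rewrite lexx ler01.
  apply: aeW => x; rewrite /through/= /wrap_set/= !in_itv/= !lexx !ler01/=.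
  move=> [[[w xw we]|[w xw we]] _]; split=> //; last by left; exists w => //; lra.
  by have := fell_sub01 xw; rewrite /= in_itv/= => /andP[]; lra.
have glue0 x y : through 0 (splice 2^-1 x y) <-> through 0 x.
  rewrite /through/= !in_itv/= lexx; split=> [[[]//|[_ /andP[]]]|x0]; first by lra.
  by left; split=> //; lra.
have glue1 x y : through 1 (splice 2^-1 x y) <-> through 1 y.
  rewrite /through/= !in_itv/= lexx; split=> [[[_ /andP[]]|[]//]|y1]; first by lra.
  by right; split=> //; lra.
apply: filterS2.
- by move=> x h0 h1; split; [exact: h0|exact: h1].
- apply: filterS ae01 => x /ce/= h01 x0.
  by apply: (e0 1); apply/(glue1 x)/h01/(glue0 x fell_empty).
- apply: filterS (ce _ ae10) => y /= h10 y1.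
  by apply: (e0 0); apply/(glue0 _ y)/h10/(glue1 fell_empty y).
Qed.

End admissible_laws.

(** * Laws dominated by a factorizing law *)

Section infimum.
Context {R : realType}.
Local Notation T := (fellB R).
Implicit Types (mu nu pi : probability T R) (P A B : set T) (x y : T) (s t : R).
Implicit Types F : set (probability T R).

Lemma ae_dominates mu nu P : mu `<< nu ->
  (\forall x \ae nu, P x) -> \forall x \ae mu, P x.
Proof. by move=> /dominatesP mn [A [mA nuA PA]]; exists A; split => //; exact: mn. Qed.

(** May fail for sets containing 0 or 1, because the shift does not identify these
  two points. *)
Lemma fell_shiftK t x : 0 <= t <= 1 -> ~ through 0 x -> ~ through 1 x ->
  fell_shift t (fell_shift (1 - t) x) = x.
Proof.
move=> /andP[t0 t1] x0 x1; apply: fell_eq => z.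
have x01 w : (x : set R) w -> 0 < w < 1.
  move=> xw; have := fell_sub01 xw; rewrite /= in_itv/= !le_eqVlt.
  move=> /andP[/predU1P[w0|->] /predU1P[w1|->]]//; exfalso.
  - by apply: x0; rewrite /through/= w0.
  - by apply: x0; rewrite /through/= w0.
  - by apply: x1; rewrite /through/= -w1.
split.
  move=> [[[_ [[[w xw <-]|[w xw <-]] _] <-]|[_ [[[w xw <-]|[w xw <-]] _] <-]] /=];
    rewrite /= in_itv/= => /andP[z0 z1]; have /andP[w0 w1] := x01 _ xw.
  - by exfalso; lra.
  - by rewrite (_ : _ + t = w)//; lra.
  - by rewrite (_ : _ - 1 = w)//; lra.
  - by exfalso; lra.
move=> xz; have /andP[z0 z1] := x01 _ xz.
split; last by rewrite /= in_itv/=; lra.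
have [zt|tz] := leP z t.
  right; exists (z + (1 - t)); last by lra.
  by split; [left; exists z|rewrite /= in_itv/=; lra].
left; exists (z + (1 - t) - 1); last by lra.
by split; [right; exists z|rewrite /= in_itv/=; lra].
Qed.

(** The set shifted by [s] contains [s] only if the set itself contains 0 or 1. *)
Lemma admissible_through mu s : admissible mu -> 0 <= s <= 1 ->
  \forall x \ae mu, ~ through s x.
Proof.
move=> amu s01; have [sta _ _] := amu.
apply: (iffLR (sta s (~` through s) s01 _)).
  by apply: measurableC; exact: measurable_through.
apply: filterS (admissible_endpoints amu) => x [x0 x1].
move=> [[[w xw we]|[w xw we]] _].
  by apply: x0; rewrite /through/= (_ : 0 = w)//; lra.
by apply: x1; rewrite /through/= (_ : 1 = w)//; lra.
Qed.

(** The cut point belongs to both halves, so [y] may contribute it to the left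
  half of [splice s x y]. *)
Lemma splice_left s x y z : 0 < s < 1 -> ~ through s y ->
  splice s (splice s x y) z = splice s x z.
Proof.
move=> /andP[s0 s1] ys; apply: fell_eq => w /=; rewrite !in_itv/=; split.
  move=> [[[[xw _]|[yw /andP[sw _]]] /andP[w0 ws]]|h]; last by right.
    by left; split=> //; rewrite w0.
  have ws' : w = s by apply/le_anti; rewrite ws sw.
  by exfalso; apply: ys; rewrite /through/= -ws'.
by move=> [[xw ws]|h]; [left; split=> //; left|right].
Qed.

Lemma splice_right s x y z : 0 < s < 1 -> ~ through s x ->
  splice s z (splice s x y) = splice s z y.
Proof.
move=> /andP[s0 s1] xs; apply: fell_eq => w /=; rewrite !in_itv/=; split.
  move=> [h|[[[xw /andP[_ ws]]|[yw _]] /andP[sw w1]]]; first by left.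
    have ws' : w = s by apply/le_anti; rewrite ws sw.
    by exfalso; apply: xs; rewrite /through/= -ws'.
  by right; split=> //; rewrite sw.
by move=> [h|[yw ws]]; [left|right; split=> //; right].
Qed.

(** Let [E] carry [pi] so that [mu] restricted to [E] is dominated by [pi]. In the
  product description of [mu], [E] is contained up to a null set in the
  rectangle [E1] x [E2] of those halves that can be completed to an element of
  [E] with positive probability. Fubini on [E] shows that [mu] restricted to [E1],
  seen through left halves only, is dominated by the left marginal of [pi];
  likewise on the right. So an event almost sure for two independent copies of
  [pi] is [mu] x [mu]-almost sure on the rectangle, thus on [E]. *)
Lemma dominated_factorizing mu pi s P : admissible mu -> pi `<< mu ->
  0 < s < 1 -> measurable P ->
  (\forall x \ae pi, \forall y \ae pi, P (splice s x y)) ->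
  \forall x \ae pi, P x.
Proof.
move=> amu pimu s01 mP Pae; have [_ fac _] := amu.
have ns : \forall x \ae mu, ~ through s x.
  by apply: admissible_through => //; have /andP[? ?] := s01; lra.
have [E [mE piE muE]] : exists E, [/\ measurable E, \forall x \ae pi, E x &
    forall Q : set T, measurable Q -> (\forall x \ae pi, Q x) ->
      \forall x \ae mu, E x -> Q x].
  have [A [mA piA] Amax] := sigma_ideal_exhaustion mu (null_sigma_ideal pi).
  exists (~` A); split; first exact: measurableC.
  - by apply/(ae_measurableP _ (measurableC mA)); rewrite setCK.
  - move=> Q mQ /(ae_measurableP _ mQ) piQ.
    have mAQ : measurable (A `|` Q) by exact: measurableU.
    have : \forall x \ae mu, (A `|` Q) x.
      apply/(ae_measurableP _ mAQ); rewrite setCU setIC -setDE; apply: Amax.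
      by split=> //; exact: measurableC.
    by apply: filterS => x [].
have mEs := measurable_splice s mE.
pose E1 := [set x : T | ~ \forall y \ae mu, ~ E (splice s x y)].
pose E2 := [set y : T | ~ \forall x \ae mu, ~ E (splice s x y)].
have mE2 : measurable E2.
  apply: measurableC; have mswap : measurable_fun setT (fun z : T * T => (z.2, z.1)).
    by apply: measurable_fun_pair; [exact: measurable_snd|exact: measurable_fst].
  exact: (measurable_ae mu (measurable_preim mswap (measurableC mEs))).
have aeE1 : \forall x \ae mu, \forall y \ae mu, E (splice s x y) -> E1 x.
  apply: aeW => x; have [E1x|/contrapT nE1x] := pselect (E1 x); first exact: aeW.
  by apply: filterS nE1x => y nExy /nExy.
have aeE2 : \forall x \ae mu, \forall y \ae mu, E (splice s x y) -> E2 y.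
  have mEE2 : measurable [set z : T * T | E (splice s z.1 z.2) -> E2 z.2].
    exact: measurable_imply mEs (measurable_preim measurable_snd mE2).
  apply/(ae_swap mu mu mEE2); apply: aeW => y.
  have [E2y|/contrapT nE2y] := pselect (E2 y); first by apply: aeW => x.
  by apply: filterS nE2y => x nExy /nExy.
(* The last premise says that D depends only on the left half of its argument,
   up to the cut point. *)
have left_half (D : set T) : measurable D -> (\forall x \ae pi, D x) ->
    (forall x y, ~ through s y -> D (splice s x y) -> D x) ->
    \forall x \ae mu, E1 x -> D x.
  move=> mD /(muE _ mD) DE Dsat.
  have mED := measurable_imply mE mD.
  move: DE => /(fac _ _ s01 mED); apply: filterS => x xD E1x.
  apply: contrapT => nDx; apply: E1x; apply: filterS2 ns xD => y ys ED Exy.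
  by apply: nDx; apply: Dsat ys (ED Exy).
have right_half (D : set T) : measurable D -> (\forall y \ae pi, D y) ->
    (forall x y, ~ through s x -> D (splice s x y) -> D y) ->
    \forall y \ae mu, E2 y -> D y.
  move=> mD /(muE _ mD) DE Dsat.
  have mED := measurable_imply mE mD.
  move: DE => /(fac _ _ s01 mED)/(ae_swap _ _ (measurable_splice s mED)).
  apply: filterS => y yD E2y.
  apply: contrapT => nDy; apply: E2y; apply: filterS2 ns yD => x xs ED Exy.
  by apply: nDy; apply: Dsat xs (ED Exy).
have mPs := measurable_splice s mP.
have PE : \forall x \ae mu, \forall y \ae mu, E1 x -> E2 y -> P (splice s x y).
  have /left_half h : measurable [set x | \forall y \ae pi, P (splice s x y)].
    exact: measurable_ae mPs.
  have {}h := h Pae.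
  apply: filterS (h _) => [x xD|].
    have [E1x|nE1x] := pselect (E1 x); last by apply: aeW.
    have /right_half h' : measurable [set y | P (splice s x y)].
      exact: measurable_section mPs.
    apply: filterS (h' (xD E1x) _) => [y yD _|]; first exact: yD.
    by move=> x' y x's /=; rewrite splice_right.
  move=> x y ys /=; apply: filterS => z; by rewrite splice_left.
have mEP := measurable_imply mE mP.
have : \forall x \ae mu, E x -> P x.
  apply/(fac _ _ s01 mEP); apply: filterS3 aeE1 aeE2 PE => x.
  by apply: filterS3 => y E1x E2y EP Exy; apply: EP; [exact: E1x|exact: E2y].
move=> /(ae_dominates pimu); apply: filterS2 piE => x Ex; exact.
Qed.
End infimum.

(** * Infima *)

Section generated_null_sets.
Context {R : realType}.
Local Notation T := (fellB R).
Implicit Types (mu nu pi : probability T R) (P A B : set T) (x y : T) (s t : R).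
Implicit Types F : set (probability T R).

(** Generated by countable unions alone, so that properties of its members are
  proved by induction on their generation; [generated_null_ideal] shows that
  subsets are included. *)
Inductive generated_null F : set T -> Prop :=
| generated_null_base nu A :
    F nu -> measurable A -> nu A = 0%E -> generated_null F A
| generated_null_bigcup (G : nat -> set T) :
    (forall n, generated_null F (G n)) -> generated_null F (\bigcup_n G n).

Lemma generated_null_ideal F mu : F mu -> sigma_ideal (generated_null F).
Proof.
move=> Fmu.
have gm A : generated_null F A -> measurable A.
  by elim=> // G _ mG; apply: bigcup_measurable => n _; exact: mG.
split=> //.
- by apply: (generated_null_base Fmu); [exact: measurable0|exact: measure0].
- move=> A B gA mB BA; rewrite -(setIidr BA) => {BA}; elim: gA.
    move=> nu {}A Fnu mA nuA; apply: (generated_null_base Fnu).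
      exact: measurableI.
    by apply: subset_measure0 nuA; [exact: measurableI|exact: mA|exact: subIsetl].
  by move=> G _ IH; rewrite setI_bigcupl; exact: generated_null_bigcup.
- exact: generated_null_bigcup.
Qed.

(** The empty set, being an atom of all members of [F], lies in no generated null
  set; so the ideal is proper and its law charges the empty set. Invariance of
  the ideal under the shifts by [t] and by [1 - t] gives both directions of
  stationarity, since the two shifts are almost surely inverse to each other. *)
Lemma infimum_admissible F mu : F mu -> (forall nu, F nu -> admissible nu) ->
  exists pi, [/\ admissible pi, forall nu, F nu -> pi `<< nu &
    forall rho : probability T R, (forall nu, F nu -> rho `<< nu) -> rho `<< pi].
Proof.
move=> Fmu Fadm; have idF := generated_null_ideal Fmu; have [Fm _ _ _] := idF.
have ne A : generated_null F A -> ~ A fell_empty.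
  elim=> [nu {}A Fnu mA nuA|G _ IH [n _ /IH//]].
  have [_ _ ce] := Fadm _ Fnu; apply: (ce (~` A)).
  by apply/(ae_measurableP _ (measurableC mA)); rewrite setCK.
have [||pi piE] := @sigma_ideal_probability _ T R mu _ idF.
- by move=> /ne; apply.
- by move=> A mA muA; exact: generated_null_base muA.
have piP P : measurable P ->
    (\forall x \ae pi, P x) <-> generated_null F (~` P).
  move=> mP; apply: (iff_trans (ae_measurableP pi mP)).
  by apply: piE; exact: measurableC.
have piF nu : F nu -> pi `<< nu.
  by move=> Fnu; apply/dominatesP => A mA nuA; apply/piE => //;
    exact: generated_null_base nuA.
exists pi; split=> //; last first.
  move=> rho rhoF; apply/dominatesP => A mA /(piE _ mA); elim=> {mA}.
    by move=> nu {}A Fnu mA nuA; move/dominatesP: (rhoF _ Fnu); apply.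
  move=> G gG rhoG; apply: measure_negligible.
    by apply: bigcup_measurable => n _; exact: Fm.
  by apply: negligible_bigcup => n; apply/negligibleP; [exact: Fm|exact: rhoG].
have shift_pi t P : 0 <= t <= 1 -> measurable P -> (\forall x \ae pi, P x) ->
    \forall x \ae pi, P (fell_shift t x).
  move=> t01 mP; have mPt := measurable_preim (measurable_fell_shift t) mP.
  move=> /(piP _ mP) gP; apply/(piP _ mPt).
  rewrite -[X in generated_null _ X]/((fell_shift t) @^-1` (~` P)).
  elim: gP.
    move=> nu A Fnu mA nuA; have [sta _ _] := Fadm _ Fnu.
    have mAC := measurableC mA.
    have mAt := measurable_preim (measurable_fell_shift t) mA.
    apply: (generated_null_base Fnu) => //.
    rewrite -[X in nu X]setCK; apply/(ae_measurableP nu (measurableC mAt)).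
    apply/(sta t (~` A) t01 mAC); apply/(ae_measurableP nu mAC).
    by rewrite setCK.
  by move=> G _ IH; rewrite preimage_bigcup; exact: generated_null_bigcup.
split.
- move=> t P t01 mP; split; last exact: shift_pi.
  have mPt := measurable_preim (measurable_fell_shift t) mP.
  have t01' : 0 <= 1 - t <= 1 by have /andP[? ?] := t01; apply/andP; split; lra.
  move=> /(shift_pi _ _ t01' mPt) /= h.
  have := ae_dominates (piF _ Fmu) (admissible_endpoints (Fadm _ Fmu)).
  by apply: filterS2 h => x + [x0 x1]; rewrite fell_shiftK.
- move=> s P s01 mP; split; last first.
    exact: dominated_factorizing (Fadm _ Fmu) (piF _ Fmu) s01 mP.
  move=> /(piP _ mP); rewrite -[P in X in _ -> X]setCK; elim.
    move=> nu A Fnu mA nuA; have [_ fac _] := Fadm _ Fnu.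
    have mAC := measurableC mA.
    have : \forall x \ae nu, (~` A) x by apply/(ae_measurableP _ mAC); rewrite setCK.
    move=> /(fac _ _ s01 mAC) /(ae_dominates (piF _ Fnu)).
    by apply: filterS => x; exact: ae_dominates (piF _ Fnu).
  move=> G _ IH; have := ae_foralln IH; apply: filterS => x xG.
  have := ae_foralln xG; apply: filterS => y yG [n _]; exact: yG.
- move=> P [A [mA piA PA]]; apply: contrapT => nP0.
  by apply: (ne A); [exact/piE|exact: PA].
Qed.
End generated_null_sets.

(** * Upper bounds of countable families *)

Section upper_bounds.
Context {R : realType}.
Local Notation T := (fellB R).
Implicit Types (mu nu a b pi : probability T R) (P : set T) (x y : T) (s t : R).

Lemma charges_empty_measurable mu :
  (forall P, measurable P -> (\forall x \ae mu, P x) -> P fell_empty) ->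
  charges_empty mu.
Proof.
move=> h P [A [mA muA PA]]; apply: contrapT => nP0.
have mAC := measurableC mA.
by apply: (h _ mAC); [apply/(ae_measurableP _ mAC); rewrite setCK|exact: PA].
Qed.

Lemma fell_union0 x : fell_union (x, fell_empty) = x.
Proof. by apply: fell_eq => z; split=> [[]//|]; left. Qed.

Lemma fell_0union x : fell_union (fell_empty, x) = x.
Proof. by apply: fell_eq => z; split=> [[]//|]; right. Qed.

Lemma fell_shift_union t x y :
  fell_shift t (fell_union (x, y)) =
  fell_union (fell_shift t x, fell_shift t y).
Proof.
apply: fell_eq => z; split.
  by move=> [[[w [xw|yw] <-]|[w [xw|yw] <-]] z01];
    [left|right|left|right]; split=> //; [left|left|right|right]; exists w.
by move=> [] [[[w xw <-]|[w xw <-]] z01]; split=> //;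
  [left|right|left|right]; exists w => //; [left|left|right|right].
Qed.

Lemma splice_union s x x' y y' :
  fell_union (splice s x x', splice s y y') =
  splice s (fell_union (x, y)) (fell_union (x', y')).
Proof.
apply: fell_eq => z; split; rewrite /=.
  by move=> [[[? ?]|[? ?]]|[[? ?]|[? ?]]]; [left|right|left|right];
    split=> //; [left|left|right|right].
by move=> [[[?|?] ?]|[[?|?] ?]]; [left; left|right; left|left; right|right; right].
Qed.

(** The other factor is empty with positive probability. *)
Lemma convolution_dominates a b : admissible a -> admissible b ->
  a `<< convolution a b /\ b `<< convolution a b.
Proof.
move=> [_ _ cea] [_ _ ceb]; split; apply/dominates_aeP => P mP.
  move=> /(ae_convolution _ _ mP); apply: filterS => x /ceb.
  by rewrite fell_union0.
move=> /(ae_convolution _ _ mP)/cea; apply: filterS => x.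
by rewrite fell_0union.
Qed.

(** Shifting and cutting commute with unions, so after expanding both factors the
  two sides differ by the order of the four independent variables only; the
  middle two are exchanged by Fubini. *)
Lemma convolution_admissible a b :
  admissible a -> admissible b -> admissible (convolution a b).
Proof.
move=> [sta fca cea] [stb fcb ceb]; split.
- move=> t P t01 mP; have mU := measurable_union_section mP.
  have mPt := measurable_preim (measurable_fell_shift t) mP.
  apply: (iff_trans (ae_convolution _ _ mPt)).
  apply: iff_trans (iff_sym (ae_convolution _ _ mP)).
  apply: iff_trans (sta t _ t01 (measurable_ae b mU)).
  apply: eq_ae => x; apply: iff_trans (stb t _ t01 (measurable_section _ mU)).
  by apply: eq_ae => y; rewrite /= fell_shift_union.
- move=> s P s01 mP; have mU := measurable_union_section mP.
  have mPs := measurable_splice s mP.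
  apply: (iff_trans (ae_convolution _ _ mP)).
  apply: (iff_trans (fca s _ s01 (measurable_ae b mU))).
  apply: iff_trans (iff_sym (ae_convolution a b (measurable_ae _ mPs))).
  apply: eq_ae => x.
  pose V (x x' y : T) := \forall y' \ae b,
    P (splice s (fell_union (x, y)) (fell_union (x', y'))).
  apply: (@iff_trans _ (\forall x' \ae a, \forall y \ae b, V x x' y)).
    apply: eq_ae => x'.
    apply: (iff_trans (fcb s _ s01 (measurable_section (splice s x x') mU))).
    by apply: eq_ae => y; apply: eq_ae => y'; rewrite /= splice_union.
  have mV : measurable [set z : T * T | V x z.1 z.2].
    pose f (w : (T * T) * T) : T * T :=
      (fell_union (x, w.1.2), fell_union (w.1.1, w.2)).
    have mf : measurable_fun setT f.
      apply: measurable_fun_pair.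
        apply: measurableT_comp (measurable_fell_union) _.
        apply: measurable_fun_pair; first exact: measurable_cst.
        by apply: measurableT_comp; [exact: measurable_snd|exact: measurable_fst].
      apply: measurableT_comp (measurable_fell_union) _.
      apply: measurable_fun_pair; last exact: measurable_snd.
      by apply: measurableT_comp; [exact: measurable_fst|exact: measurable_fst].
    exact: (measurable_ae b (measurable_preim mf mPs)).
  apply: (iff_trans (ae_swap a b mV)); apply: eq_ae => y.
  by apply: iff_sym; apply: (ae_convolution a b (measurable_section _ mPs)).
- apply: charges_empty_measurable => P mP /(ae_convolution _ _ mP)/cea/ceb.
  by rewrite fell_union0.
Qed.

(** The splice of the mixture takes its left half from some [u n] and its right
  half from some [u m]; both laws are dominated by the later one, which
  factorizes. *)
Lemma chain_supremum_admissible (u : nat -> probability T R) :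
  (forall n, admissible (u n)) -> (forall n, u n `<< u n.+1) ->
  exists pi, admissible pi /\ forall n, u n `<< pi.
Proof.
move=> uadm umon; have [pi piE] := sequence_probability u.
have piP P : measurable P ->
    (\forall x \ae pi, P x) <-> forall n, \forall x \ae u n, P x.
  move=> mP; apply: (iff_trans (ae_measurableP pi mP)).
  apply: (iff_trans (piE _ (measurableC mP))).
  by split=> h n; apply/(ae_measurableP _ mP); exact: h.
have upi n : u n `<< pi by apply/dominates_aeP => P mP /(piP _ mP); exact.
have ule m n : (m <= n)%N -> u m `<< u n.
  elim: n => [|n IH]; first by rewrite leqn0 => /eqP ->.
  rewrite leq_eqVlt => /predU1P[->//|/IH mn].
  exact: null_dominates_trans mn (umon n).
exists pi; split=> //; split.
- move=> t P t01 mP; have mPt := measurable_preim (measurable_fell_shift t) mP.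
  apply: (iff_trans (piP _ mPt)); apply: iff_trans (iff_sym (piP _ mP)).
  by split=> h n; have [sta _ _] := uadm n; apply/(sta t P t01 mP)/h.
- move=> s P s01 mP; have mPs := measurable_splice s mP.
  apply: iff_trans (iff_sym (piP _ (measurable_ae pi mPs))).
  apply: (iff_trans (piP _ mP)); split=> h n.
    have hmn m : \forall x \ae u n, \forall y \ae u m, P (splice s x y).
      have [_ fac _] := uadm (maxn m n).
      have /(fac _ _ s01 mP) := h (maxn m n).
      move=> /(ae_dominates (ule _ _ (leq_maxr m n))); apply: filterS => x.
      exact: ae_dominates (ule _ _ (leq_maxl m n)).
    have := ae_foralln hmn; apply: filterS => x hx.
    exact/(piP _ (measurable_section x mPs)).
  have [_ fac _] := uadm n; apply/(fac _ _ s01 mP).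
  by apply: filterS (h n) => x; exact: ae_dominates (upi n).
- have [_ _ ce] := uadm 0%N => P /(ae_dominates (upi 0%N)); exact: ce.
Qed.

Lemma sequence_upper_bound (nu : nat -> probability T R) :
  (forall n, admissible (nu n)) ->
  exists pi, admissible pi /\ forall n, nu n `<< pi.
Proof.
move=> nuadm.
pose u := fix u n := if n is m.+1 then convolution (u m) (nu m.+1) else nu 0%N.
have uadm n : admissible (u n).
  by elim: n => [|n IH] /=; [exact: nuadm|exact: convolution_admissible].
have [|pi [piadm upi]] := chain_supremum_admissible uadm.
  by move=> n; apply: (convolution_dominates (uadm n) (nuadm n.+1)).1.
exists pi; split=> // -[|n]; first exact: (upi 0%N).
apply: null_dominates_trans (upi n.+1).
exact: (convolution_dominates (uadm n) (nuadm n.+1)).2.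
Qed.

Lemma empty_admissible : admissible (\d_(@fell_empty R : T) : probability T R).
Proof.
have shift0 t : fell_shift t (@fell_empty R) = fell_empty.
  by apply: fell_eq => z; split=> // -[[[w []]|[w []]]].
have splice0 s : splice s (@fell_empty R) fell_empty = fell_empty.
  by apply: fell_eq => z; split=> // -[[]|[]].
split.
- move=> t P t01 mP; have mPt := measurable_preim (measurable_fell_shift t) mP.
  by rewrite (ae_diracP _ mPt) (ae_diracP _ mP) /= shift0.
- move=> s P s01 mP; have mPs := measurable_splice s mP.
  rewrite (ae_diracP _ mP) (ae_diracP _ (measurable_ae _ mPs)).
  apply: iff_sym; apply: (iff_trans (ae_diracP _ (measurable_section _ mPs))).
  by rewrite /= splice0.
- by apply: charges_empty_measurable => P mP /(ae_diracP _ mP).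
Qed.

Lemma empty_dominated mu :
  charges_empty mu -> (\d_(@fell_empty R : T) : probability T R) `<< mu.
Proof. by move=> ce; apply/dominates_aeP => P mP /ce P0; apply/ae_diracP. Qed.

End upper_bounds.

(** * Order theory *)

Section posets_with_infima.
Context {d : Order.disp_t} {T : porderType d}.
Variable X : set T.
Hypothesis X_inf : forall A, A `<=` X -> A !=set0 -> exists s, is_glb_in X A s.

(** The supremum is the infimum of the upper bounds. *)
Lemma bounded_has_lub A u : A `<=` X -> X u -> ubound A u ->
  exists s, is_lub_in X A s.
Proof.
move=> AX Xu Au; have [||s [[Xs sB] Bs]] := @X_inf (X `&` ubound A).
- by move=> x [].
- by exists u.
exists s; split=> //; split=> // a Aa; apply: Bs; split; first exact: AX.
by move=> b [_ /(_ a Aa)].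
Qed.

(** Adding the top [f] of the interval to a family makes it nonempty without
  changing its infimum in the interval; this also covers the empty family. *)
Lemma infima_relatively_complete : is_relatively_complete X.
Proof.
move=> e f Xe Xf ef A AI; split.
  have [||s [[Xs sB] Bs]] := @X_inf (order_interval X e f `&` ubound A).
  - by move=> x [[]].
  - exists f; split; first by split=> //=; rewrite ef lexx.
    by move=> a /AI[_ /andP[]].
  exists s; split=> //; split.
    split=> //=; apply/andP; split.
      by apply: Bs; split=> // b [[_ /andP[]]].
    apply: sB; split; first by split=> //=; rewrite ef lexx.
    by move=> a /AI[_ /andP[]].
  move=> a Aa; apply: Bs; split; first by have [] := AI _ Aa.
  by move=> b [_ /(_ a Aa)].
have [||s [[Xs sA] As]] := @X_inf (A `|` [set f]).
- by move=> x [/AI[]//|->].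
- by exists f; right.
exists s; split.
  split; last by move=> a Aa; apply: sA; left.
  split=> //=; apply/andP; split; last by apply: sA; right.
  by apply: As; split=> // b [/AI[_ /andP[]]//|->].
move=> b [[Xb /andP[_ bf]] bA]; apply: As; split=> // a [/bA//|->//].
Qed.

Lemma infima_sigma_complete :
  (forall A, A `<=` X -> countable A -> A !=set0 ->
     exists2 u, X u & ubound A u) ->
  is_sigma_complete X.
Proof.
move=> X_ub A AX cA A0; split; last exact: X_inf.
by have [u Xu Au] := X_ub A AX cA A0; exact: bounded_has_lub Au.
Qed.

End posets_with_infima.

Lemma sigma_complete_lattice d (T : porderType d) (X : set T) :
  is_sigma_complete X -> is_lattice X.
Proof.
move=> sX x y Xx Xy; apply: sX; last by exists x; left.
  by move=> _ [->|->].
exact: finite_set_countable.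
Qed.

Section stationary_factorizing_types.
Context {R : realType}.
Local Notation T := (fellB R).
Local Notation X := (stat_fact_types R).

Lemma stat_fact_types_inf (A : set (mtype T R)) : A `<=` X -> A !=set0 ->
  exists s, is_glb_in X A s.
Proof.
move=> AX [M AM]; have [mu Mmu] := mtypeE M.
have [||pi [piadm pilb piglb]] :=
    @infimum_admissible R [set nu | A (mtype_of nu)] mu.
- by rewrite /= -Mmu.
- by move=> nu /AX /stat_fact_typesP.
exists (mtype_of pi); split.
  split; first exact/stat_fact_typesP.
  by move=> N; have [nu ->] := mtypeE N => /pilb pinu; apply/mtype_ac_of.
move=> N; have [rho ->] := mtypeE N => -[_ rholb]; apply/mtype_ac_of.
by apply: piglb => nu /rholb /mtype_ac_of.
Qed.

Lemma stat_fact_types_countable_bound (A : set (mtype T R)) : A `<=` X ->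
  countable A -> A !=set0 -> exists2 U, X U & ubound A U.
Proof.
move=> AX /countable_injP[code codeI] [M AM].
have /choice[nu nuP] : forall n, exists nu : probability T R,
    admissible nu /\ forall N, A N -> code N = n -> N = mtype_of nu.
  move=> n; have [[N [AN codeN]]|nN] := pselect (exists N, A N /\ code N = n).
    have [nu Nnu] := mtypeE N; exists nu; split.
      by apply/stat_fact_typesP; rewrite -Nnu; exact: AX.
    move=> N' AN' codeN'; rewrite -Nnu; apply: codeI; rewrite ?inE//.
    by rewrite codeN codeN'.
  have [mu Mmu] := mtypeE M; exists mu; split.
    by apply/stat_fact_typesP; rewrite -Mmu; exact: AX.
  by move=> N AN codeN; exfalso; apply: nN; exists N.
have [|pi [piadm nupi]] := @sequence_upper_bound R nu.
  by move=> n; exact: (nuP n).1.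
exists (mtype_of pi); first exact/stat_fact_typesP.
move=> N AN; rewrite ((nuP (code N)).2 N AN erefl).
by apply/mtype_ac_of; exact: nupi.
Qed.

Lemma stat_fact_types_least : is_least X (mtype_dirac (@fell_empty R)).
Proof.
split; first by apply/stat_fact_typesP; exact: empty_admissible.
move=> M XM; have [mu Mmu] := mtypeE M; rewrite Mmu; apply/mtype_ac_of.
apply: empty_dominated; have /stat_fact_typesP[] : X (mtype_of mu) by rewrite -Mmu.
by [].
Qed.

End stationary_factorizing_types.

Theorem proposition5p11 (R : realType) :
  [/\ is_lattice (stat_fact_types R),
      is_relatively_complete (stat_fact_types R),
      is_sigma_complete (stat_fact_types R) &
      is_least (stat_fact_types R) (mtype_dirac (@fell_empty R))].
Proof.
have sX := infima_sigma_complete (@stat_fact_types_inf R)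
  (@stat_fact_types_countable_bound R).
split=> //; [exact: sigma_complete_lattice| |exact: stat_fact_types_least].
exact: infima_relatively_complete (@stat_fact_types_inf R).
Qed.
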